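(* Let $A$ be a subset of $\mathbb{Z}_p^d$ such that no hyperplane contains more than $|A|/(4W)$ elements of $A$. Then for all subsets $Y$ of $\mathbb{Z}_p^d$ containing at most $p^d/2$ elements, there is an element $a\in A$ such that $$|(a+Y)\setminus Y|\ge \frac{W}{5p}\,|Y|.$$
   Context: Here $p$ is a prime, $d$ is a positive integer, $W$ is a positive real number, and $\mathbb{Z}_p^d$ is the direct sum of $d$ copies of the cyclic group $\mathbb{Z}_p$ of order $p$, regarded as a $d$-dimensional vector space over the field with $p$ elements; hyperplanes are hyperplanes of this space. For $a\in\mathbb{Z}_p^d$, $a+Y=\{a+y : y\in Y\}$, and $|X|$ denotes the number of elements of a finite set $X$.
   Formalization: A is assumed nonempty, W ≥ 13/50 replaces W > 0, and hyperplanes are affine: the claim fails for A empty, for W ≤ 1/4 (A = Y = {0}) and for some W just above 1/4, and with only hyperplanes through the origin (d = 1, A = {1}). *)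

(* Defs.v *)
From HB Require Import structures.
From mathcomp Require Import all_boot all_order all_algebra.
From mathcomp Require Import reals.

Set Implicit Arguments.
Unset Strict Implicit.
Unset Printing Implicit Defensive.

Import Order.TTheory GRing.Theory Num.Theory.
Local Open Scope ring_scope.

(* Hyperplanes are affine: cosets of the subspaces of codimension 1, not only
   those through the origin. For d = 1 they are the points. *)
Definition hyperplane (p d : nat) (H : {set 'rV['F_p]_d}) : Prop :=
  exists (U : {vspace 'rV['F_p]_d}) (x : 'rV['F_p]_d),
    (\dim U).+1 = d /\ H = [set v | v - x \in U].

Definition translate (p d : nat) (a : 'rV['F_p]_d) (Y : {set 'rV['F_p]_d}) :
    {set 'rV['F_p]_d} :=
  [set a + y | y in Y].

(* Main.v *)
Require Import Defs.
From mathcomp Require Import all_boot all_order all_algebra.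
From mathcomp Require Import reals.
From mathcomp Require Import algC cyclotomic ring lra zify.

(** Write e(a) for the number of y in Y with y + a outside Y, so that e(a) is
    the size of (a + Y) \ Y. It is subadditive in a, hence an element a with
    small e(a) forces all the translates Y + i a, for 0 <= i < k, to overlap
    heavily: the translates by i a and j a share at least |Y| - |i - j| e(a)
    points. Summed over i and j, this bounds from below the number of collisions
    x + i a = y + j a with x, y in Y and i, j < k
    ([collisions_lower_bound]).

    Fourier analysis bounds the same number from above, on average over a in A.
    Parseval turns it into p^-d times the sum over the frequencies xi of
    |Y^(xi)|^2 |D(<xi, a>)|^2, where Y^ is the Fourier transform of the
    indicator of Y and D(t) is the geometric sum of the k terms w^(t i). For
    xi <> 0 the values <xi, a> are spread over the level sets of <xi, _>, which
    are hyperplanes and so hold at most M = |A| / (4 W) elements of A each.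
    Hence the sum over a in A of |D(<xi, a>)|^2 is at most M times the sum of
    |D(t)|^2 over all residues t, which is p k by Parseval again. No pointwise
    information on D is needed, because |D|^2 is nonnegative and its total mass
    is known ([collisions_upper_bound]). As Y fills at most half of the space,
    the frequency 0 accounts for at most half of the trivial bound k^2 |Y|.

    Averaging e itself, that is taking k = 2, would lose a factor of order p / W,
    because 1 - cos is quadratic near 0. The choice of k of the order of p / W
    balances the two bounds: for k = x p / W they give an average of e over A of
    at least W |Y| / (5 p) as soon as x^2 <= 15/2 (x - 1/4), which holds for x
    from 13/50 to 5/4 ([escape_sum_lower_bound]); an integer k <= p in this range
    always exists ([exists_step_count]). *)

Set Implicit Arguments.
Unset Strict Implicit.
Unset Printing Implicit Defensive.

Import Order.TTheory GRing.Theory Num.Theory.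
Local Open Scope ring_scope.

(** * Characters and Parseval's identity *)

Definition fp_char (p : nat) (w : algC) (t : 'F_p) : algC := w ^+ t.

Lemma fp_charD (p : nat) (w : algC) :
  prime p -> p.-primitive_root w ->
  {morph @fp_char p w : s t / s + t >-> s * t}.
Proof.
move=> p_pr w_prim s t; rewrite /fp_char /= -exprD.
rewrite -[in RHS](prim_expr_mod w_prim); congr (w ^+ (_ %% _)).
exact: Fp_cast.
Qed.

Lemma normC_fp_char (p : nat) (w : algC) (t : 'F_p) :
  prime p -> p.-primitive_root w -> `|fp_char w t| = 1.
Proof.
move=> p_pr w_prim; apply/eqP.
rewrite -(@pexpr_eq1 _ _ p) ?normr_ge0 ?prime_gt0 //.
rewrite -normrX /fp_char exprAC.
by rewrite (prim_expr_order w_prim) expr1n normr1.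
Qed.

Lemma conj_fp_char (p : nat) (w : algC) (t : 'F_p) :
  prime p -> p.-primitive_root w -> (fp_char w t)^* = fp_char w (- t).
Proof.
move=> p_pr w_prim; have nt := normC_fp_char t p_pr w_prim.
have t_neq0 : fp_char w t != 0 by rewrite -normr_eq0 nt oner_eq0.
apply: (mulfI t_neq0).
by rewrite -normCK nt expr1n -fp_charD // subrr.
Qed.

Lemma fp_char_neq1 (p : nat) (w : algC) (t : 'F_p) :
  prime p -> p.-primitive_root w -> t != 0 -> fp_char w t != 1.
Proof.
move=> p_pr w_prim t_neq0; rewrite /fp_char -(prim_order_dvd w_prim).
apply: contra t_neq0 => p_dvd_t; rewrite -val_eqE /=.
move: p_dvd_t; case: (posnP t) => [->//|t_gt0] /(dvdn_leq t_gt0).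
by have := ltn_ord t; rewrite [X in (_ < X)%N]Fp_cast // ltnNge => /negbTE->.
Qed.

(** Translating the summation variable by g multiplies the sum by chi g, which
    is not 1. *)
Lemma sum_additive_char (G : finZmodType) (chi : G -> algC) (g : G) :
  {morph chi : x y / x + y >-> x * y} -> chi g != 1 -> \sum_x chi x = 0.
Proof.
move=> chiD chi_g; apply/eqP.
have : (1 - chi g) * (\sum_x chi x) = 0.
  rewrite mulrBl mul1r [X in X - _](reindex_inj (addrI g)) /= mulr_sumr.
  by apply/eqP; rewrite subr_eq0; apply/eqP/eq_bigr => x _; rewrite chiD.
by move/eqP; rewrite mulf_eq0 subr_eq0 eq_sym (negbTE chi_g).
Qed.

(** Stated for a family z of points with repetitions and for any orthogonal
    system chi, so that one identity covers the transform of a set, that of a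
    multiset of translates, and the one-dimensional geometric sums. The right
    side counts the pairs of indices with equal points. *)
Lemma parseval (X I : finType) (T : eqType) (chi : X -> T -> algC) (N : algC)
    (P : pred I) (z : I -> T) :
  (forall u v, \sum_x chi x u * (chi x v)^* = N * (u == v)%:R) ->
  \sum_x `|\sum_(i | P i) chi x (z i)| ^+ 2 =
    N * (\sum_(i | P i) \sum_(j | P j) (z i == z j))%N%:R.
Proof.
move=> orth; rewrite natr_sum mulr_sumr.
transitivity
    (\sum_(i | P i) \sum_(j | P j) \sum_x chi x (z i) * (chi x (z j))^*).
  under [RHS]eq_bigr => i _ do rewrite exchange_big /=.
  rewrite exchange_big /=; apply: eq_bigr => x _.
  rewrite normCK rmorph_sum mulr_suml; apply: eq_bigr => i _.
  by rewrite mulr_sumr.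
apply: eq_bigr => i _; rewrite natr_sum mulr_sumr.
by apply: eq_bigr => j _; apply: orth.
Qed.

Definition dotp (p d : nat) (xi v : 'rV['F_p]_d) : 'F_p := (xi *m v^T) 0 0.

Lemma dotpDl (p d : nat) (v : 'rV['F_p]_d) :
  {morph (fun xi => dotp xi v) : xi eta / xi + eta >-> xi + eta}.
Proof. by move=> xi eta; rewrite /dotp mulmxDl mxE. Qed.

Lemma dotpDr (p d : nat) (xi : 'rV['F_p]_d) :
  {morph dotp xi : u v / u + v >-> u + v}.
Proof. by move=> u v; rewrite /dotp linearD mulmxDr mxE. Qed.

Lemma dotpBr (p d : nat) (xi u v : 'rV['F_p]_d) :
  dotp xi (u - v) = dotp xi u - dotp xi v.
Proof. by rewrite /dotp linearB mulmxBr !mxE. Qed.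

Lemma dotpMnr (p d : nat) (xi v : 'rV['F_p]_d) (n : nat) :
  dotp xi (v *+ n) = dotp xi v *+ n.
Proof. by rewrite /dotp linearMn -scaler_nat -scalemxAr mxE mulr_natl. Qed.

Lemma dotpZr (p d : nat) (xi v : 'rV['F_p]_d) (c : 'F_p) :
  dotp xi (c *: v) = c * dotp xi v.
Proof. by rewrite /dotp linearZ -scalemxAr mxE. Qed.

Lemma dotp0l (p d : nat) (v : 'rV['F_p]_d) : dotp 0 v = 0.
Proof. by rewrite /dotp mul0mx mxE. Qed.

Lemma dotpC (p d : nat) (xi v : 'rV['F_p]_d) : dotp xi v = dotp v xi.
Proof. by rewrite /dotp -[in RHS](trmxK v) -trmx_mul [RHS]mxE. Qed.

Lemma exists_dotp (p d : nat) (xi : 'rV['F_p]_d) (t : 'F_p) :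
  xi != 0 -> exists v, dotp xi v = t.
Proof.
case/rV0Pn => i xi_i; exists (t / xi 0 i *: delta_mx 0 i).
have e : dotp xi (delta_mx 0 i) = xi 0 i.
  by rewrite /dotp trmx_delta -colE mxE.
by rewrite dotpZr e divfK.
Qed.

Lemma fp_char_orthogonal (p : nat) (w : algC) (s t : 'F_p) :
  prime p -> p.-primitive_root w ->
  \sum_(x : 'F_p) fp_char w (x * s) * (fp_char w (x * t))^* =
    p%:R * (s == t)%:R.
Proof.
move=> p_pr w_prim.
under eq_bigr => x _ do rewrite conj_fp_char // -fp_charD // -mulrBr.
have [->|neq_st] := eqVneq s t.
  under eq_bigr => x _ do rewrite subrr mulr0.
  by rewrite sumr_const card_Fp // mulr1.
rewrite mulr0 (@sum_additive_char _ _ 1) //.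
- by move=> x y; rewrite mulrDl fp_charD.
- by rewrite mul1r fp_char_neq1 // subr_eq0.
Qed.

(** For u <> v some frequency pairs with u - v to 1, which makes the character
    xi |-> w^<xi, u - v> nontrivial. *)
Lemma dotp_char_orthogonal (p d : nat) (w : algC) (u v : 'rV['F_p]_d) :
  prime p -> p.-primitive_root w ->
  \sum_(xi : 'rV['F_p]_d) fp_char w (dotp xi u) * (fp_char w (dotp xi v))^* =
    (p ^ d)%:R * (u == v)%:R.
Proof.
move=> p_pr w_prim.
under eq_bigr => x _ do rewrite conj_fp_char // -fp_charD // -dotpBr.
have [->|neq_uv] := eqVneq u v.
  under eq_bigr => x _ do rewrite subrr dotpC dotp0l.
  by rewrite sumr_const card_mx card_Fp // mul1n mulr1.
have [xi xi1] : exists xi, dotp (u - v) xi = 1.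
  by apply: exists_dotp; rewrite subr_eq0.
rewrite mulr0 (@sum_additive_char _ _ xi) //.
- by move=> x y; rewrite dotpDl fp_charD.
- by rewrite dotpC xi1 fp_char_neq1 // oner_eq0.
Qed.

(** * Translates of a set along a progression *)

Definition escape (G : finZmodType) (Y : {set G}) (a : G) : nat :=
  #|[set y in Y | y + a \notin Y]|.

(** If y leaves Y when moved by a + b, then either it already leaves Y when moved
    by a, or y + a is a point of Y that leaves Y when moved by b. *)
Lemma escapeD (G : finZmodType) (Y : {set G}) (a b : G) :
  (escape Y (a + b)%R <= escape Y a + escape Y b)%N.
Proof.
apply: leq_trans (leq_add (leqnn _) (leq_imset_card (+%R^~ (- a)) _)).
apply: leq_trans (leq_card_setU _ _); apply: subset_leq_card.
apply/subsetP => y; rewrite !inE addrA => /andP[yY yabY].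
rewrite yY; case: (boolP (y + a \in Y)) => //= yaY.
by apply/imsetP; exists (y + a); rewrite ?addrK // inE yaY.
Qed.

Lemma escapeMn (G : finZmodType) (Y : {set G}) (a : G) (m : nat) :
  (escape Y (a *+ m) <= m * escape Y a)%N.
Proof.
elim: m => [|m IHm].
  rewrite leqn0 cards_eq0; apply/eqP/setP => y.
  by rewrite !inE mulr0n addr0 andbN.
rewrite mulrS mulSn; apply: leq_trans (escapeD _ _ _) _.
by rewrite leq_add2l.
Qed.

(** Up to normalization, the squared L2 norm of the convolution of the indicator
    of Y with the progression 0, a, ..., (k-1) a. *)
Definition collisions (G : finZmodType) (Y : {set G}) (a : G) (k : nat) : nat :=
  \sum_(u : G * 'I_k | u.1 \in Y) \sum_(v : G * 'I_k | v.1 \in Y)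
    (u.1 + a *+ u.2 == v.1 + a *+ v.2)%R.

(** The double sum is the size of the intersection of Y + i a and Y + j a. By
    translation it counts the points of Y that stay in Y when moved by
    |i - j| a. The distance |i - j| is the sum of two truncated differences, one
    of which vanishes. *)
Lemma card_le_overlap (G : finZmodType) (Y : {set G}) (a : G) (i j : nat) :
  (#|Y| <= \sum_(x in Y) \sum_(y in Y) (x + a *+ i == y + a *+ j)%R +
           ((i - j) + (j - i)) * escape Y a)%N.
Proof.
wlog le_ji : i j / (j <= i)%N => [hwlog|].
  have [/hwlog//|/ltnW/hwlog] := leqP j i.
  rewrite exchange_big [(j - i + _)%N]addnC /=.
  under [X in (_ <= X + _)%N -> _]eq_bigr => x _.
    under eq_bigr => y _ do rewrite eq_sym. over.
  by [].
rewrite (eqP le_ji) addn0.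
have -> : (\sum_(x in Y) \sum_(y in Y) (x + a *+ i == y + a *+ j)%R =
           #|[set x in Y | (x + a *+ (i - j)%N)%R \in Y]|)%N.
  rewrite -sum1_card big_mkcond [RHS]big_mkcond; apply: eq_bigr => x _.
  rewrite inE; case: (x \in Y) => //=.
  have eq_x y : (x + a *+ i == y + a *+ j) = (y == x + a *+ (i - j)%N).
    by rewrite -{1}(subnK le_ji) mulrnDr addrA (inj_eq (addIr _)) eq_sym.
  under eq_bigr => y _ do rewrite eq_x.
  case: ifP => mem.
    rewrite (bigD1 (x + a *+ (i - j)%N)) //= eqxx big1 // => y /andP[_ /negbTE->].
    by [].
  by rewrite big1 // => y yY; case: eqP => // eq_y; rewrite -eq_y yY in mem.
apply: leq_trans (leq_add (leqnn _) (escapeMn Y a (i - j))).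
rewrite -(cardsID [set x | (x + a *+ (i - j)%N)%R \in Y] Y) leq_add //.
  by apply: subset_leq_card; apply/subsetP => x; rewrite !inE.
by apply: subset_leq_card; apply/subsetP => x; rewrite !inE andbC.
Qed.

Lemma sum_ord_dist (k : nat) :
  (3 * (\sum_(i < k) \sum_(j < k) ((i - j) + (j - i))) + k = k ^ 3)%N.
Proof.
elim: k => [|k IHk]; first by rewrite big_ord0.
have sum_last : (\sum_(i < k) ((i - k) + (k - i)) = 'C(k.+1, 2))%N.
  rewrite -bin2_sum big_mkord big_ord_recl add0n (reindex_inj rev_ord_inj) /=.
  by apply: eq_bigr => i _; have := ltn_ord i; rewrite /bump leq0n; lia.
have sum_last' : (\sum_(j < k) ((k - j) + (j - k)) = 'C(k.+1, 2))%N.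
  by rewrite -sum_last; apply: eq_bigr => i _; rewrite addnC.
rewrite big_ord_recr /= big_ord_recr /= subnn !addn0 sum_last'.
under eq_bigr => i _ do rewrite big_ord_recr /=.
rewrite big_split /= sum_last.
have := mul_bin_diag k.+1 1; rewrite bin1 /= => eqC.
have -> : (k.+1 ^ 3 = k ^ 3 + 3 * (k.+1 * k) + 1)%N by ring.
by rewrite -IHk eqC -[k.+1]addn1; ring.
Qed.

(** The term k^3 comes from the exact sum (k^3 - k) / 3 of the distances |i - j|;
    bounding that sum by k^3 / 2 instead would lose the final constant for W
    near 13/50. *)
Lemma collisions_lower_bound (G : finZmodType) (Y : {set G}) (a : G) (k : nat) :
  (3 * k ^ 2 * #|Y| <= 3 * collisions Y a k + k ^ 3 * escape Y a)%N.
Proof.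
have -> : collisions Y a k = (\sum_(i < k) \sum_(j < k)
    \sum_(x in Y) \sum_(y in Y) (x + a *+ i == y + a *+ j)%R)%N.
  rewrite /collisions.
  transitivity (\sum_(x in Y) \sum_(i < k) \sum_(y in Y) \sum_(j < k)
      (x + a *+ i == y + a *+ j)%R)%N.
    rewrite [RHS]pair_big /=; apply: eq_big => [[x i]|[x i] _] /=.
      by rewrite andbT.
    by rewrite [RHS]pair_big /=; apply: eq_big => [[y j]|] //=; rewrite andbT.
  rewrite exchange_big; apply: eq_bigr => i _ /=.
  rewrite [RHS]exchange_big; apply: eq_bigr => x _ /=.
  by rewrite exchange_big.
have : (\sum_(i < k) \sum_(j < k) #|Y| <= \sum_(i < k) \sum_(j < k)
    (\sum_(x in Y) \sum_(y in Y) (x + a *+ i == y + a *+ j)%R +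
           ((i - j) + (j - i)) * escape Y a))%N.
  by apply: leq_sum => i _; apply: leq_sum => j _; apply: card_le_overlap.
under [X in (_ <= X)%N]eq_bigr => i _ do rewrite big_split -big_distrl /=.
rewrite big_split -big_distrl /= !sum_nat_const !card_ord.
have := sum_ord_dist k.
set C := (\sum_(i < k) _)%N; set D := (\sum_(i < k) _)%N; set e := escape _ _.
nia.
Qed.

(** * The Fourier bound on collisions *)

(** As k <= p, the residues of 0, ..., k-1 are distinct, so in Parseval's identity
    only the diagonal pairs collide. *)
Lemma sum_sqr_geometric (p : nat) (w : algC) (k : nat) :
  prime p -> p.-primitive_root w -> (k <= p)%N ->
  \sum_(t : 'F_p) `|\sum_(i < k) fp_char w (t *+ i)| ^+ 2 = (p * k)%:R.
Proof.
move=> p_pr w_prim le_kp.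
under eq_bigr => t _ do under eq_bigr => i _ do rewrite -mulr_natr.
rewrite (@parseval _ _ _ (fun t s => fp_char w (t * s)) p%:R) => [|s t]; last first.
  exact: fp_char_orthogonal.
rewrite -natrM; congr (p * _)%:R.
rewrite -[RHS](card_ord k) -sum1_card; apply: eq_bigr => i _.
rewrite (bigD1 i) //= eqxx big1 // => j /negbTE neq_ji.
case: eqP => // eq_ij; rewrite -val_eqE /= in neq_ji; case/eqP: neq_ji.
have := congr1 val eq_ij => /=; rewrite !val_Fp_nat //.
by rewrite !modn_small // (leq_trans (ltn_ord _)).
Qed.

Lemma sum_sqr_geometric_dotp_le (p d : nat) (A : {set 'rV['F_p]_d}) (w : algC)
    (k M : nat) (xi : 'rV['F_p]_d) :
  prime p -> p.-primitive_root w -> (k <= p)%N ->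
  (forall t, #|[set v in A | dotp xi v == t]| <= M)%N ->
  \sum_(a in A) `|\sum_(i < k) fp_char w (dotp xi a *+ i)| ^+ 2 <=
    (p * k * M)%:R.
Proof.
move=> p_pr w_prim le_kp fiberM.
rewrite (partition_big (dotp xi) xpredT) //= natrM -(sum_sqr_geometric p_pr w_prim le_kp).
rewrite mulr_suml; apply: ler_sum => t _.
under eq_bigr => a /andP[_ /eqP->] do [].
rewrite sumr_const -[X in X <= _]mulr_natr ler_wpM2l ?exprn_ge0 ?normr_ge0 //.
rewrite ler_nat; apply: leq_trans (fiberM t).
by apply: subset_leq_card; apply/subsetP => v; rewrite !inE.
Qed.

(** Divided by p^d, this is k^2 |Y|^2 / p^d for each a, from the frequency 0, plus
    p k M times the mass |Y| - |Y|^2 / p^d of the other frequencies; the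
    subtracted term is moved to the left to stay in the natural numbers. *)
Lemma collisions_upper_bound (p d : nat) (A Y : {set 'rV['F_p]_d}) (k M : nat) :
  prime p -> (k <= p)%N ->
  (forall xi t, xi != 0%R -> #|[set v in A | dotp xi v == t]| <= M)%N ->
  (p ^ d * (\sum_(a in A) collisions Y a k) + p * k * M * #|Y| ^ 2 <=
   #|A| * k ^ 2 * #|Y| ^ 2 + p * k * M * (p ^ d * #|Y|))%N.
Proof.
move=> p_pr le_kp fiberM.
have [w w_prim] := C_prim_root_exists (prime_gt0 p_pr).
pose F (xi : 'rV['F_p]_d) := `|\sum_(y in Y) fp_char w (dotp xi y)| ^+ 2.
pose D (xi a : 'rV['F_p]_d) := `|\sum_(i < k) fp_char w (dotp xi a *+ i)| ^+ 2.
have orth := fun u v => @dotp_char_orthogonal p d w u v p_pr w_prim.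
have sumF : \sum_xi F xi = (p ^ d * #|Y|)%:R.
  rewrite /F (parseval _ _ orth) -natrM; congr (_ * _)%:R.
  rewrite -sum1_card; apply: eq_bigr => y yY.
  by rewrite (bigD1 y) //= eqxx big1 // => x /andP[_ /negbTE]; rewrite eq_sym => ->.
have sumFD a : \sum_xi F xi * D xi a = (p ^ d * collisions Y a k)%:R.
  rewrite natrM -(parseval _ _ orth); apply: eq_bigr => xi _.
  rewrite -exprMn -normrM; congr (`|_| ^+ 2).
  rewrite mulr_suml.
  under eq_bigr => y _ do rewrite mulr_sumr.
  rewrite pair_big /=; apply: eq_big => [[y i]|[y i] _] /=; first by rewrite andbT.
  by rewrite dotpDr fp_charD // dotpMnr.
have F0 : F 0 = (#|Y| ^ 2)%:R.
  rewrite /F; under eq_bigr => y _ do rewrite dotp0l.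
  by rewrite /fp_char expr0 sumr_const normr_nat natrX.
have D0 : \sum_(a in A) D 0 a = (#|A| * k ^ 2)%:R.
  rewrite /D; under eq_bigr => a _.
    under eq_bigr => i _ do rewrite dotp0l mul0rn.
    rewrite /fp_char expr0 sumr_const card_ord normr_nat. over.
  by rewrite sumr_const natrM natrX mulr_natl.
have sumFDA : (p ^ d * \sum_(a in A) collisions Y a k)%:R =
    \sum_xi F xi * \sum_(a in A) D xi a.
  rewrite big_distrr natr_sum /=.
  under eq_bigr => a _ do rewrite -sumFD.
  by rewrite exchange_big; apply: eq_bigr => xi _; rewrite -mulr_sumr.
rewrite -(ler_nat algC) !natrD sumFDA [X in _ + X <= _]natrM [X in _ <= X + _]natrM.
rewrite [X in _ <= _ + X]natrM -F0 -sumF -D0.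
rewrite (bigD1 0) //= [X in _ <= _ + _ * X](bigD1 0) //= mulrDr.
rewrite [F 0 * _]mulrC -!addrA lerD2l [X in X <= _]addrC lerD2l mulr_sumr.
apply: ler_sum => xi xi_neq0; rewrite mulrC.
rewrite ler_wpM2r ?exprn_ge0 ?normr_ge0 //.
by apply: sum_sqr_geometric_dotp_le => // t; apply: fiberM.
Qed.

(** * Hyperplanes as level sets *)

Lemma hyperplane_fiber (p d : nat) (xi : 'rV['F_p]_d) (t : 'F_p) :
  prime p -> xi != 0 -> hyperplane [set v | dotp xi v == t].
Proof.
move=> p_pr xi_neq0; have [x xt] := exists_dotp t xi_neq0.
pose f : 'Hom('rV['F_p]_d, 'rV['F_p]_1) := linfun (mulmxr xi^T).
have fE v : f v = const_mx (dotp xi v).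
  by rewrite lfunE /= dotpC; apply/matrixP => i j; rewrite !ord1 [RHS]mxE.
exists (lker f), x; split; last first.
  apply/setP => v; rewrite !inE memv_ker fE dotpBr xt -subr_eq0.
  apply/eqP/eqP => [->|]; first by apply/matrixP => i j; rewrite !mxE.
  by move/matrixP/(_ 0 0); rewrite !mxE.
have dim_rV m : dim 'rV['F_p]_m = m by rewrite dim_matrix; apply: mul1n.
have dimf := limg_ker_dim f fullv; rewrite capfv dimvf dim_rV in dimf.
apply: etrans dimf; suff -> : (f @: fullv)%VS = fullv by rewrite dimvf dim_rV addn1.
apply/eqP; rewrite eqEsubv subvf; apply/subvP => u _.
have [v vu] := exists_dotp (u 0 0) xi_neq0.
have -> : u = f v by rewrite fE vu; apply/matrixP => i j; rewrite !ord1 mxE.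
by rewrite memv_img ?memvf.
Qed.

Lemma card_le_fibers (p d : nat) (A : {set 'rV['F_p]_d}) (M : nat)
    (xi : 'rV['F_p]_d) :
  prime p -> (forall t, #|[set v in A | dotp xi v == t]| <= M)%N ->
  (#|A| <= p * M)%N.
Proof.
move=> p_pr fiberM; rewrite -sum1_card (partition_big (dotp xi) xpredT) //=.
rewrite -[in leqRHS](card_Fp p_pr) -sum_nat_const; apply: leq_sum => t _.
rewrite sum1_card; apply: leq_trans (fiberM t).
by apply: subset_leq_card; apply/subsetP => v; rewrite !inE.
Qed.

(** * Choice of the number of steps and conclusion *)

Lemma card_translateD (p d : nat) (a : 'rV['F_p]_d) (Y : {set 'rV['F_p]_d}) :
  #|translate a Y :\: Y| = escape Y a.
Proof.
suff -> : translate a Y :\: Y = +%R^~ a @: [set y in Y | y + a \notin Y].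
  by rewrite card_imset //; apply: addIr.
apply/setP => z; apply/setDP/imsetP => [[/imsetP[y yY ->] yaY]|[y]].
  by exists y; rewrite ?inE ?yY addrC.
by rewrite inE => /andP[yY yaY] ->; split=> //; rewrite addrC imset_f.
Qed.

(** For W <= 1 the whole cyclic group, k = p, is used: the quotient k W / p is then
    W, which is where the lower limit 13/50 comes from. For W > 1 the least
    integer above p / W works, since adding at most 1 to p / W >= 4 multiplies it
    by at most 5/4. *)
Lemma exists_step_count (R : realType) (p : nat) (W : R) :
  prime p -> 13 / 50 <= W -> 4 <= p%:R / W ->
  exists k : nat, [/\ (0 < k <= p)%N, 13 / 50 * (p%:R / W) <= k%:R
                    & k%:R <= 5 / 4 * (p%:R / W)].
Proof.
move=> p_pr W_ge r_ge4; have p_gt0 := prime_gt0 p_pr.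
have W_gt0 : 0 < W by lra.
have pR_gt0 : 0 < p%:R :> R by rewrite ltr0n.
have pE : p%:R = W * (p%:R / W) by rewrite mulrC divfK ?gt_eqF.
move: pE r_ge4; set r := _ / W => pE r_ge4.
have [W_le1|W_gt1] := lerP W 1.
  exists p; rewrite p_gt0 leqnn; split=> //; nra.
have r_ge0 : 0 <= r by lra.
exists (Num.truncn r).+1; split; last 2 first.
- have := truncnS_gt r; lra.
- by have := truncn_le r; rewrite -natr1; lra.
by rewrite /= truncn_lt_nat //; nra.
Qed.

(** The numerical core, with n = |A|, y = |Y|, q = p^d, r = p / W, m = p M and L the
    sum of e over A. The last hypothesis is the comparison of the two bounds on
    collisions, divided by k. *)
Lemma escape_sum_lower_bound (R : realType) (n y q k r m L : R) :
  0 < n -> 0 < y -> 0 < q -> 0 < r -> y <= q / 2 -> m <= n * r / 4 ->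
  13 / 50 * r <= k -> k <= 5 / 4 * r ->
  3 * k * n * y * (q - y) <= 3 * m * y * (q - y) + k ^+ 2 * L * q ->
  n * (y / (5 * r)) <= L.
Proof.
move=> n_gt0 y_gt0 q_gt0 r_gt0 y_le m_le k_ge k_le main.
have k_gt0 : 0 < k by lra.
have mass : 3 / 2 * (n * y) * (k - r / 4) * q <= k ^+ 2 * L * q.
  have h1 : m * (y * (q - y)) <= n * r / 4 * (y * (q - y)).
    by apply: ler_wpM2r => //; apply: mulr_ge0; lra.
  have h2 : n * y * (k - r / 4) * (q / 2) <= n * y * (k - r / 4) * (q - y).
    by apply: ler_wpM2l; [rewrite !mulr_ge0 //; lra | lra].
  lra.
move: mass; rewrite ler_pM2r // => mass.
(* In terms of x = k / r this is x^2 <= 15/2 (x - 1/4), true on [13/50, 5/4]. *)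
have quad : k ^+ 2 <= 15 / 2 * (k - r / 4) * r by nra.
have k2_gt0 : 0 < k ^+ 2 by rewrite exprn_gt0.
rewrite -(ler_pM2l k2_gt0); apply: le_trans mass.
have -> : k ^+ 2 * (n * (y / (5 * r))) = n * y / (5 * r) * k ^+ 2 by field; lra.
have -> : 3 / 2 * (n * y) * (k - r / 4) =
          n * y / (5 * r) * (15 / 2 * (k - r / 4) * r) by field; lra.
by apply: ler_wpM2l => //; rewrite divr_ge0 ?mulr_ge0 //; lra.
Qed.

Theorem theorem3 (R : realType) (p d : nat) (W : R)
    (p_prime : prime p) (d_gt0 : (0 < d)%N) (W_ge : 13 / 50 <= W)
    (A : {set 'rV['F_p]_d}) (A_neq0 : A != set0)
    (hA : forall H : {set 'rV['F_p]_d}, hyperplane H ->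
      #|A :&: H|%:R <= #|A|%:R / (4 * W)) :
  forall Y : {set 'rV['F_p]_d}, #|Y|%:R <= (p%:R ^+ d / 2 : R) ->
  exists2 a : 'rV['F_p]_d, a \in A &
    W / (5 * p%:R) * #|Y|%:R <= #|translate a Y :\: Y|%:R.
Proof.
move=> Y Y_le; have W_gt0 : 0 < W by lra.
have p_gt0 : 0 < p%:R :> R by rewrite ltr0n prime_gt0.
have n_gt0 : 0 < #|A|%:R :> R by rewrite ltr0n card_gt0.
have [->|Y_neq0] := eqVneq Y set0.
  have [a aA] := set0Pn _ A_neq0; exists a => //.
  by rewrite cards0 mulr0 ler0n.
have y_gt0 : 0 < #|Y|%:R :> R by rewrite ltr0n card_gt0.
set r : R := p%:R / W; have r_gt0 : 0 < r by rewrite divr_gt0.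
have n4W_ge0 : 0 <= #|A|%:R / (4 * W) by rewrite divr_ge0 //; lra.
pose M := Num.truncn (#|A|%:R / (4 * W)).
have fiberM (xi : 'rV_d) t :
    xi != 0 -> (#|[set v in A | dotp xi v == t]| <= M)%N.
  move=> xi_neq0; rewrite truncn_ge_nat //.
  by apply: le_trans (hA _ (hyperplane_fiber t p_prime xi_neq0)); rewrite setIdE.
have m_le : (p * M)%:R <= #|A|%:R * r / 4.
  have -> : #|A|%:R * r / 4 = p%:R * (#|A|%:R / (4 * W)) by rewrite /r; field; lra.
  by rewrite natrM ler_wpM2l ?truncn_le // ltW.
(* The p level sets of one nonzero frequency cover A, so 4 W cannot exceed p. *)
have r_ge4 : 4 <= r.
  have xi_neq0 : const_mx 1 != 0 :> 'rV['F_p]_d.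
    by apply/rV0Pn; exists (Ordinal d_gt0); rewrite mxE oner_eq0.
  have := card_le_fibers p_prime (fun t => fiberM _ t xi_neq0).
  rewrite -(ler_nat R); nra.
have [k [/andP[k_gt0 k_le_p] k_ge k_le]] := exists_step_count p_prime W_ge r_ge4.
pose L := (\sum_(a in A) escape Y a)%N.
have kR_gt0 : 0 < k%:R :> R by rewrite ltr0n.
(* Both bounds on collisions, summed over A; eliminating the collision count and
   cancelling a factor k gives the comparison. *)
have lower : (3 * k ^ 2 * #|Y| * #|A| <=
              3 * (\sum_(a in A) collisions Y a k) + k ^ 3 * L)%N.
  rewrite mulnC -sum_nat_const !big_distrr -big_split /=.
  by apply: leq_sum => a _; apply: collisions_lower_bound.
have upper := collisions_upper_bound Y p_prime k_le_p fiberM.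
have main : 3 * k%:R * #|A|%:R * #|Y|%:R * (p%:R ^+ d - #|Y|%:R) <=
    3 * (p * M)%:R * #|Y|%:R * (p%:R ^+ d - #|Y|%:R) +
    k%:R ^+ 2 * L%:R * p%:R ^+ d :> R.
  rewrite -(ler_pM2l kR_gt0).
  move: lower upper; rewrite -!(ler_nat R) !(natrM, natrD, natrX).
  have : 0 < p%:R ^+ d :> R by rewrite exprn_gt0.
  move: (_ ^+ d) => q q_gt0; rewrite -(ler_pM2l q_gt0).
  move: (\sum_(a in A) collisions Y a k)%N => C lower upper.
  lra.
have q_gt0 : 0 < p%:R ^+ d :> R by rewrite exprn_gt0.
have := escape_sum_lower_bound n_gt0 y_gt0 q_gt0 r_gt0 Y_le m_le k_ge k_le main.
have -> : W / (5 * p%:R) * #|Y|%:R = #|Y|%:R / (5 * r) by rewrite /r; field; lra.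
move: (_ / _) => delta L_ge.
have [/exists_inP[a aA le_a]|no_a] := boolP [exists a in A, delta <= (escape Y a)%:R].
  by exists a; rewrite ?card_translateD.
move: L_ge; rewrite leNgt => /negP[]; rewrite natr_sum.
rewrite mulr_natl -sumr_const; apply: ltr_sum.
  by have [a aA] := set0Pn _ A_neq0; apply/hasP; exists a; rewrite ?mem_index_enum.
move=> a aA; rewrite ltNge; apply: contra no_a => le_a.
by apply/exists_inP; exists a.
Qed.
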